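(* None of the following three cost functions for discrete-time mixed $\mathcal{H}_2/\mathcal{H}_\infty$ design is coercive in general: $$\mathcal{J}(K)=\mathrm{tr}(P_KDD^\top),$$ $$\mathcal{J}(K)=-\gamma^2\log\det(I-\gamma^{-2}P_KDD^\top),$$ $$\mathcal{J}(K)=\mathrm{tr}\big[D^\top P_K(I-\gamma^{-2}DD^\top P_K)^{-1}D\big].$$ That is, as $K\to\partial\mathcal{K}$, where $\partial\mathcal{K}$ is the boundary of the feasible set $\mathcal{K}$, the cost $\mathcal{J}(K)$ does not necessarily approach infinity: for each of these costs there exist problem data $(A,B,C,D,E,\gamma)$ and a sequence in $\mathcal{K}$ converging to a point of $\partial\mathcal{K}$ along which $\mathcal{J}$ does not tend to $+\infty$.
   Context: Setting (discrete-time mixed $\mathcal{H}_2/\mathcal{H}_\infty$ design). $A\in\mathbb{R}^{m\times m}$, $B\in\mathbb{R}^{m\times d}$, $C\in\mathbb{R}^{l\times m}$, $D\in\mathbb{R}^{m\times n}$, $E\in\mathbb{R}^{l\times d}$ are real matrices satisfying $E^\top[C\ \ E]=[0\ \ R]$ for some $R>0$, and $\gamma>0$. Gains are $K\in\mathbb{R}^{d\times m}$. $\rho(\cdot)$ is the spectral radius, $X>0$ ($X\ge0$) denotes (symmetric) positive definite (semidefinite), $X^{-\top}=(X^{-1})^\top$. A square matrix is stable if its spectral radius is $<1$. Transfer function: $\mathcal{T}(K)(z)=(C^\top C+K^\top RK)^{1/2}\,(zI-(A-BK))^{-1}D$, with $\|\mathcal{T}(K)\|_\infty=\sup_{\theta\in[0,2\pi)}\lambda_{\max}^{1/2}\big[\mathcal{T}(K)(e^{-j\theta})^\top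 \mathcal{T}(K)(e^{j\theta})\big]$. Feasible set: $\mathcal{K}=\{K:\rho(A-BK)<1,\ \|\mathcal{T}(K)\|_\infty<\gamma\}$. For $K\in\mathcal{K}$, $P_K$ denotes the unique stabilizing solution (it exists by the discrete-time Bounded Real Lemma) of the Riccati equation $(A-BK)^\top\tilde P_K(A-BK)+C^\top C+K^\top RK-P_K=0$, where $\tilde P_K:=P_K+P_KD(\gamma^2I-D^\top P_KD)^{-1}D^\top P_K$; i.e., the unique solution $P_K\ge0$ with $I-\gamma^{-2}D^\top P_KD>0$ and $(I-\gamma^{-2}P_KDD^\top)^{-\top}(A-BK)$ stable. *)

(* Defs.v *)
From HB Require Import structures.
From mathcomp Require Import all_boot all_order all_algebra.
From mathcomp Require Import complex.
From mathcomp Require Import all_classical all_reals all_analysis.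

Set Implicit Arguments.
Unset Strict Implicit.
Unset Printing Implicit Defensive.

Import Order.TTheory GRing.Theory Num.Theory.
Import numFieldNormedType.Exports.

Local Open Scope classical_set_scope.
Local Open Scope ring_scope.

Section MatrixNotions.
Context {R : realType}.

Definition posdefmx n (X : 'M[R]_n) : Prop :=
  X^T = X /\ forall v : 'cV[R]_n, v != 0 -> 0 < (v^T *m X *m v) 0 0.

Definition possemidefmx n (X : 'M[R]_n) : Prop :=
  X^T = X /\ forall v : 'cV[R]_n, 0 <= (v^T *m X *m v) 0 0.

Definition complexmx m n (X : 'M[R]_(m, n)) : 'M[R[i]]_(m, n) :=
  map_mx (real_complex R) X.

(* The norm of R[i] takes its values in R[i]; 'complex.Re' brings it to R. *)
Definition spectral_radius n (X : 'M[R]_n) : R :=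
  sup [set complex.Re `|z| | z in [set z | eigenvalue (complexmx X) z]].

Definition stablemx n (X : 'M[R]_n) : Prop := spectral_radius X < 1.

(* Largest real eigenvalue; meant for Hermitian matrices, all of whose
   eigenvalues are real. *)
Definition lambda_max n (M : 'M[R[i]]_n) : R :=
  sup [set x : R | eigenvalue M x%:C%C].

(* The principal square root: the unique positive semidefinite root of a
   positive semidefinite matrix. *)
Definition psd_sqrtmx n (X : 'M[R]_n) : 'M[R]_n :=
  get [set S | possemidefmx S /\ S *m S = X].

Definition boundary {T : topologicalType} (S : set T) : set T :=
  closure S `\` interior S.

End MatrixNotions.

(* 'weightR' is the weight written R in the control literature (R being the
   field of real numbers here). *)
Record design_data (R : realType) (m d l n : nat) := DesignData {
  matA : 'M[R]_m;
  matB : 'M[R]_(m, d);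
  matC : 'M[R]_(l, m);
  matD : 'M[R]_(m, n);
  matE : 'M[R]_(l, d);
  weightR : 'M[R]_d;
  gamma : R;
  weightR_eq : matE^T *m row_mx matC matE = row_mx 0 weightR;
  weightR_posdef : posdefmx weightR;
  gamma_gt0 : 0 < gamma
}.

Section Design.
Context {R : realType} {m d l n : nat}.
Variable pb : design_data R m d l n.

Local Notation A := (matA pb).
Local Notation B := (matB pb).
Local Notation C := (matC pb).
Local Notation D := (matD pb).
Local Notation g := (gamma pb).

Definition closed_loop (K : 'M[R]_(d, m)) : 'M[R]_m := A - B *m K.

Definition state_weight (K : 'M[R]_(d, m)) : 'M[R]_m :=
  C^T *m C + K^T *m weightR pb *m K.

Definition transfer (K : 'M[R]_(d, m)) (z : R[i]) : 'M[R[i]]_(m, n) :=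
  complexmx (psd_sqrtmx (state_weight K))
    *m invmx (z%:M - complexmx (closed_loop K)) *m complexmx D.

(* e^{j theta} *)
Definition expj (theta : R) : R[i] := (cos theta +i* sin theta)%C.

(* Only meaningful when 'closed_loop K' has no eigenvalue on the unit circle,
   as is the case when it is stable. *)
Definition hinf_norm (K : 'M[R]_(d, m)) : \bar R :=
  ereal_sup [set (Num.sqrt (lambda_max
      ((transfer K (expj (- theta)))^T *m transfer K (expj theta))))%:E
    | theta in [set theta : R | 0 <= theta < 2 * pi]].

Definition feasible : set 'M[R]_(d, m) :=
  [set K | stablemx (closed_loop K) /\ (hinf_norm K < g%:E)%E].

Definition P_tilde (P : 'M[R]_m) : 'M[R]_m :=
  P + P *m D *m invmx ((g ^+ 2)%:M - D^T *m P *m D) *m D^T *m P.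

Definition stabilizing_solution (K : 'M[R]_(d, m)) (P : 'M[R]_m) : Prop :=
  [/\ possemidefmx P,
      (closed_loop K)^T *m P_tilde P *m closed_loop K + state_weight K - P = 0,
      posdefmx (1%:M - g ^- 2 *: (D^T *m P *m D)) &
      stablemx ((invmx (1%:M - g ^- 2 *: (P *m D *m D^T)))^T *m closed_loop K)].

(* P = P_K, the unique stabilizing solution *)
Definition is_P_of (K : 'M[R]_(d, m)) (P : 'M[R]_m) : Prop :=
  unique (stabilizing_solution K) P.

(* The three costs, as functions of P = P_K. *)
Definition cost_trace (P : 'M[R]_m) : R := \tr (P *m D *m D^T).

Definition cost_logdet (P : 'M[R]_m) : R :=
  - g ^+ 2 * ln (\det (1%:M - g ^- 2 *: (P *m D *m D^T))).

Definition cost_game (P : 'M[R]_m) : R :=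
  \tr (D^T *m P *m invmx (1%:M - g ^- 2 *: (D *m D^T *m P)) *m D).

End Design.

(* A cost, given for all dimensions and problem data as a function of P_K. *)
Definition cost_function (R : realType) : Type :=
  forall m d l n : nat, design_data R m d l n -> 'M[R]_m -> R.

Definition not_coercive_in_general (R : realType) (J : cost_function R) : Prop :=
  exists m d l n : nat, [/\ (0 < m)%N, (0 < d)%N, (0 < l)%N & (0 < n)%N] /\
  exists pb : design_data R m d l n,
  exists (K_ : nat -> 'M[R]_(d, m)) (P_ : nat -> 'M[R]_m) (K_lim : 'M[R]_(d, m)),
    [/\ forall k, feasible pb (K_ k),
        forall k, is_P_of pb (K_ k) (P_ k),
        K_ k @[k --> \oo] --> K_lim,
        boundary (feasible pb) K_lim &
        ~ (J m d l n pb (P_ k) @[k --> \oo] --> +oo)].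

(* Main.v *)
Require Import Defs.
From mathcomp Require Import all_boot all_order all_algebra.
From mathcomp Require Import complex ring lra.
From mathcomp Require Import all_classical all_reals all_analysis.

Set Implicit Arguments.
Unset Strict Implicit.
Unset Printing Implicit Defensive.

Import Order.TTheory GRing.Theory Num.Theory.
Import numFieldNormedType.Exports.

Local Open Scope classical_set_scope.
Local Open Scope ring_scope.

(** Why the costs stay bounded: each of them can blow up only if P_K does, or if
    I - gamma^-2 D^T P_K D becomes singular in the limit.  Approaching the
    constraint on the H-infinity norm forces neither of these: it may be that
    P_K stays away from both, and that only the stability of
    (I - gamma^-2 P_K D D^T)^-T (A - B K) degenerates, the spectral radius of
    this matrix tending to 1.

    A scalar plant shows it for the three costs at once: all dimensions are 1,
    A = C = 0, B = D = E = R = 1 and gamma = 1.  Under the gain k the closed loop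
    is -k, the transfer function is |k| / (z + k), and so
<<
      ||T(k)||^2 = sup_theta k^2 / (1 + 2 k cos theta + k^2) = (k / (1 - |k|))^2,
>>
    which makes the feasible set |k| < 1/2; [feasible_scalar] and
    [half_not_feasible] show that k = 1/2 is on its boundary.
    The Riccati equation is p (1 - p) = k^2, and the stabilizing root is the one
    with |k| < 1 - p, i.e. the root below 1/2 ([stabilizing_solution_scalar]).

    With t = k / (1 - p) as parameter, everything becomes rational:
    k = t / (1 + t^2), p = t^2 / (1 + t^2) and 1 - p = 1 / (1 + t^2).  Up to sign
    t is the stabilized closed-loop pole, so t ranges over [0, 1) and the
    boundary point k = 1/2 is reached as t tends to 1.  The costs are p,
    ln (1 + t^2) and t^2, bounded by 1, ln 2 and 1. *)

(** * Scalar matrices *)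

Lemma eigenvalue_scalar_mx (F : fieldType) n (a z : F) :
  eigenvalue (a%:M : 'M[F]_n.+1) z = (z == a).
Proof.
apply/eigenvalueP/eqP => [[v] | ->].
  rewrite mul_mx_scalar => /eqP; rewrite -subr_eq0 -scalerBl scaler_eq0.
  by case/orP=> [|-> //]; rewrite subr_eq0 => /eqP.
exists (const_mx 1); first exact: mul_mx_scalar.
apply/eqP => /rowP/(_ ord0)/eqP.
by rewrite !mxE oner_eq0.
Qed.

Section ScalarMatrices.
Context {R : realType}.
Implicit Types x : R.

Lemma complexmx_scalar n x : complexmx (x%:M : 'M[R]_n) = (x%:C%C)%:M.
Proof. exact: map_scalar_mx. Qed.

Lemma spectral_radius_scalar n x : spectral_radius (x%:M : 'M[R]_n.+1) = `|x|.
Proof.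
rewrite /spectral_radius complexmx_scalar.
rewrite (_ : [set z | _] = [set x%:C%C]); last first.
  by apply/seteqP; split=> z /=; rewrite eigenvalue_scalar_mx => /eqP.
by rewrite image_set1 sup1 normc_def /= expr0n addr0 sqrtr_sqr.
Qed.

Lemma lambda_max_scalar n x : lambda_max ((x%:C%C)%:M : 'M[R[i]]_n.+1) = x.
Proof.
rewrite /lambda_max (_ : [set y | _] = [set x]) ?sup1//.
apply/seteqP; split=> y /=; rewrite eigenvalue_scalar_mx.
  by move=> /eqP/complexI.
by move=> ->.
Qed.

Lemma mx11_quadratic_form x (v : 'cV[R]_1) :
  (v^T *m x%:M *m v) 0 0 = x * v 0 0 ^+ 2.
Proof.
by rewrite mul_mx_scalar -scalemxAl mxE mxE big_ord1 mxE expr2.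
Qed.

Lemma posdefmx11 x : posdefmx (x%:M : 'M[R]_1) <-> 0 < x.
Proof.
split=> [[_ /(_ 1%:M)] | x0].
  rewrite mx11_quadratic_form mxE eqxx expr1n mulr1; apply.
  by apply/eqP => /matrixP/(_ 0 0)/eqP; rewrite !mxE eqxx oner_eq0.
split=> [|v v0]; first exact: tr_scalar_mx.
rewrite mx11_quadratic_form mulr_gt0// exprn_even_gt0//=.
by apply: contra v0 => /eqP v0; rewrite (mx11_scalar v) v0 raddf0.
Qed.

Lemma possemidefmx11 x : possemidefmx (x%:M : 'M[R]_1) <-> 0 <= x.
Proof.
split=> [[_ /(_ 1%:M)] | x0].
  by rewrite mx11_quadratic_form mxE eqxx expr1n mulr1.
split=> [|v]; first exact: tr_scalar_mx.
by rewrite mx11_quadratic_form mulr_ge0// sqr_ge0.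
Qed.

(** The square root is defined by a choice operator; semidefiniteness of the
    chosen root is what selects |x| among the two roots of x^2. *)
Lemma psd_sqrtmx11 x : psd_sqrtmx ((x ^+ 2)%:M : 'M[R]_1) = `|x|%:M.
Proof.
rewrite /psd_sqrtmx.
have : exists S : 'M[R]_1, possemidefmx S /\ S *m S = (x ^+ 2)%:M.
  exists `|x|%:M; split; first exact/possemidefmx11.
  by rewrite -scalar_mxM -expr2 real_normK// num_real.
move=> /getPex; set S := get _; rewrite (mx11_scalar S).
case=> /possemidefmx11 S0; rewrite -scalar_mxM -expr2.
move=> /matrixP/(_ 0 0); rewrite !mxE/= !mulr1n => Sx.
by rewrite -(ger0_norm S0) -!sqrtr_sqr Sx.
Qed.

Lemma cvg_scalar_mx n (u : nat -> R) (l : R) :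
  u k @[k --> \oo] --> l ->
  ((u k)%:M : 'M[R]_n.+1) @[k --> \oo] --> (l%:M : 'M[R]_n.+1).
Proof.
move=> ul; rewrite -scalemx1 (_ : (fun k => _) = (fun k => u k *: 1%:M)).
  exact: cvgZr_tmp.
by apply/funext => k; rewrite scalemx1.
Qed.

End ScalarMatrices.

Lemma bounded_above_not_cvg_pinfty (R : realType) (u : nat -> R) (M : R) :
  (forall k, u k <= M) -> ~ (u k @[k --> \oo] --> +oo).
Proof.
move=> uM /cvgryPge/(_ (M + 1))[N _ /(_ N (leqnn N))] /= /le_trans/(_ (uM N)).
by rewrite gerDl ler10.
Qed.

(** * A scalar plant *)

Section ScalarPlant.
Context {R : realType}.
Implicit Types k p t theta : R.

(** With A = C = 0 the closed loop is - k and the state weight is k^2, which is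
    what reduces the Riccati equation to the factored form p (1 - p) = k^2. *)
Definition scalar_plant : design_data R 1 1 1 1.
Proof.
refine (@DesignData R 1 1 1 1 0 1%:M 0 1%:M 1%:M 1%:M 1 _ _ ltr01).
- by rewrite tr_scalar_mx mul1mx.
- exact/posdefmx11.
Defined.

Local Notation pb := scalar_plant.

Lemma closed_loop_scalar k : closed_loop pb k%:M = (- k)%:M.
Proof. by rewrite /closed_loop /= mul1mx sub0r raddfN. Qed.

Lemma state_weight_scalar k : state_weight pb k%:M = (k ^+ 2)%:M.
Proof.
by rewrite /state_weight /= mulmx0 add0r tr_scalar_mx mulmx1 -scalar_mxM.
Qed.

Lemma transfer_scalar k (z : R[i]) :
  transfer pb k%:M z = (`|k|%:C%C * (z + k%:C%C)^-1)%:M.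
Proof.
rewrite /transfer state_weight_scalar psd_sqrtmx11 closed_loop_scalar.
rewrite !complexmx_scalar -raddfB invmx_scalar -!scalar_mxM.
by rewrite rmorph1 mulr1 rmorphN opprK.
Qed.

(** For theta real, e^{-j theta} + k is the conjugate of e^{j theta} + k, so the
    product of the two resolvents is the inverse of a squared modulus. *)
Lemma transfer_gram k theta :
  (transfer pb k%:M (expj (- theta)))^T *m transfer pb k%:M (expj theta)
  = ((k ^+ 2 / (1 + 2 * k * cos theta + k ^+ 2))%:C%C)%:M.
Proof.
rewrite !transfer_scalar tr_scalar_mx -scalar_mxM; congr scalar_mx.
rewrite mulrACA -invfM -rmorphM -expr2 real_normK ?num_real//.
rewrite [RHS]rmorphM fmorphV; congr (_ * _^-1).
rewrite /expj cosN sinN; apply/eqP; rewrite eq_complex /=.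
have := cos2Dsin2 theta => h; apply/andP; split; apply/eqP; last by ring.
lra.
Qed.

Lemma hinf_norm_scalar k : hinf_norm pb k%:M =
  ereal_sup [set (Num.sqrt (k ^+ 2 / (1 + 2 * k * cos theta + k ^+ 2)))%:E
    | theta in [set theta : R | 0 <= theta < 2 * pi]].
Proof.
rewrite /hinf_norm; congr ereal_sup; apply: eq_imagel => theta _.
by rewrite transfer_gram lambda_max_scalar.
Qed.

(** The peak of the frequency response is at theta = pi, where the denominator
    1 + 2 k cos theta + k^2 takes its least value (1 - k)^2; the norm is thus at
    most k / (1 - k), which is below 1 exactly when k is below 1/2. *)
Lemma feasible_scalar k : 0 <= k -> k < 1 / 2 -> feasible pb k%:M.
Proof.
move=> k0 k2; split.
  rewrite /Defs.stablemx closed_loop_scalar spectral_radius_scalar normrN.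
  by rewrite ger0_norm//; lra.
rewrite hinf_norm_scalar /=.
apply: (@le_lt_trans _ _ (k / (1 - k))%:E); last first.
  by rewrite lte_fin ltr_pdivrMr; lra.
apply: ge_ereal_sup => _ [theta _ <-]; rewrite lee_fin.
have k1 : 0 < 1 - k by lra.
rewrite -[leRHS]ger0_norm ?divr_ge0// ?(ltW k1)// -sqrtr_sqr ler_wsqrtr//.
rewrite expr_div_n ler_wpM2l ?sqr_ge0// lef_pV2 ?posrE ?exprn_gt0//.
  have := cos_geN1 theta; nra.
have := cos_geN1 theta; nra.
Qed.

(** At k = 1/2 the peak value k / (1 - k), at theta = pi, is already 1. *)
Lemma half_not_feasible : ~ feasible pb (1 / 2)%:M.
Proof.
case=> _; rewrite hinf_norm_scalar /=; apply/negP; rewrite -leNgt.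
apply: ereal_sup_ubound; exists pi => /=.
  by have := pi_gt0 R => h; lra.
rewrite cospi (_ : _ / (_ + _ + _) = 1 :> R) ?sqrtr1//.
by field.
Qed.

(** Here P_tilde = p + p^2 / (1 - p) = p / (1 - p), so the Riccati equation
    k^2 p / (1 - p) + k^2 - p = 0 reads k^2 / (1 - p) = p; the stabilized closed
    loop is - k / (1 - p). *)
Lemma stabilizing_solution_scalar k p :
  stabilizing_solution pb k%:M p%:M <->
  [/\ 0 <= p, p < 1, p * (1 - p) = k ^+ 2 & `|k| < 1 - p].
Proof.
rewrite /stabilizing_solution /P_tilde closed_loop_scalar state_weight_scalar /=.
rewrite !tr_scalar_mx !mulmx1 !mul1mx expr1n invr1 !scale1r -!raddfB.
rewrite !invmx_scalar /= -!scalar_mxM -!raddfD -!scalar_mxM -!raddfD -!raddfB.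
rewrite tr_scalar_mx -scalar_mxM /Defs.stablemx spectral_radius_scalar.
split=> [[/possemidefmx11 p0 e /posdefmx11]|[p0 p1 e kp]].
  rewrite subr_gt0 => p1 h; move: e => /matrixP/(_ 0 0).
  have p10 : 0 < 1 - p by lra.
  have p1N : 1 - p != 0 by rewrite gt_eqF.
  rewrite !mxE/= !mulr1n => e; split=> //.
    have {}e : (1 - p) * (- k * (p + p * (1 - p)^-1 * p) * - k + k ^+ 2 - p) = 0.
      by rewrite e mulr0.
    apply/eqP; rewrite eq_sym -subr_eq0 -e; apply/eqP; field.
    by rewrite p1N.
  move: h; rewrite normrM normrN normfV (gtr0_norm p10) mulrC.
  by rewrite ltr_pdivrMr// mul1r.
have p10 : 0 < 1 - p by lra.
have p1N : 1 - p != 0 by rewrite gt_eqF.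
split; [exact/possemidefmx11| |apply/posdefmx11 => // |].
  rewrite (_ : _ - p = 0) ?raddf0//.
  have -> : - k * (p + p * (1 - p)^-1 * p) * - k = k ^+ 2 * p / (1 - p).
    by field.
  rewrite -e; field => //.
by rewrite normrM normrN normfV (gtr0_norm p10) mulrC ltr_pdivrMr// mul1r.
Qed.

(** The gain and the Riccati solution for which the stabilized closed loop is
    - t: solving k = t (1 - p) and p (1 - p) = k^2 gives p = t^2 (1 - p). *)
Definition gain_at t : R := t / (1 + t ^+ 2).
Definition riccati_at t : R := t ^+ 2 / (1 + t ^+ 2).

Lemma one_add_sqr_gt0 t : 0 < 1 + t ^+ 2.
Proof. by rewrite ltr_wpDr ?sqr_ge0. Qed.
#[local] Hint Resolve one_add_sqr_gt0 : core.

Lemma one_add_sqr_neq0 t : 1 + t ^+ 2 != 0.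
Proof. by rewrite gt_eqF. Qed.
#[local] Hint Resolve one_add_sqr_neq0 : core.

Lemma one_sub_riccati_at t : 1 - riccati_at t = (1 + t ^+ 2)^-1.
Proof. by rewrite /riccati_at; field. Qed.

Lemma feasible_gain_at t : 0 <= t -> t < 1 -> feasible pb (gain_at t)%:M.
Proof.
move=> t0 t1; apply: feasible_scalar; first by rewrite divr_ge0// ltW.
rewrite /gain_at ltr_pdivrMr//.
have : 0 < (1 - t) ^+ 2 by rewrite exprn_gt0// subr_gt0.
nra.
Qed.

(** The two roots of p (1 - p) = k^2 add up to 1.  A stabilizing one satisfies
    k < 1 - p, hence p (1 - p) < (1 - p)^2 unless k = 0, and therefore p < 1/2;
    two such roots cannot add up to 1, so they coincide. *)
Lemma is_P_of_gain_at t : 0 <= t -> t < 1 ->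
  is_P_of pb (gain_at t)%:M (riccati_at t)%:M.
Proof.
move=> t0 t1.
have k0 : 0 <= gain_at t by rewrite divr_ge0// ltW.
have d0 := one_add_sqr_gt0 t.
have S : stabilizing_solution pb (gain_at t)%:M (riccati_at t)%:M.
  apply/stabilizing_solution_scalar; split.
  - by rewrite divr_ge0 ?sqr_ge0// ltW.
  - by rewrite ltr_pdivrMr// mul1r; lra.
  - by rewrite one_sub_riccati_at /riccati_at /gain_at; field.
  - by rewrite one_sub_riccati_at ger0_norm// /gain_at ltr_pdivrMr// mulVf.
split=> // P; rewrite (mx11_scalar P); set p := P 0 0.
move=> /stabilizing_solution_scalar[p0 p1 pk kp]; congr scalar_mx.
have small q : 0 <= q -> q < 1 -> q * (1 - q) = gain_at t ^+ 2 ->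
    `|gain_at t| < 1 - q -> q < 1 / 2.
  rewrite ger0_norm// => q0 q1 e kq; nra.
move: S => /stabilizing_solution_scalar[r0 r1 rk kr].
have p2 := small _ p0 p1 pk kp; have r2 := small _ r0 r1 rk kr.
(* The difference of the two Riccati equations, factored. *)
have /eqP : (riccati_at t - p) * (1 - p - riccati_at t) = 0.
  have : riccati_at t * (1 - riccati_at t) = p * (1 - p) by rewrite pk rk.
  by move=> h; lra.
rewrite mulf_eq0 => /orP[|/eqP]; last lra.
by rewrite subr_eq0 => /eqP.
Qed.

(** * Approaching the boundary *)

Definition pole (j : nat) : R := 1 - harmonic j.

Lemma pole_ge0 j : 0 <= pole j.
Proof. by rewrite subr_ge0 invf_le1 ?ler1n// ltr0n. Qed.

Lemma pole_lt1 j : pole j < 1.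
Proof. by rewrite ltrBlDr ltrDl harmonic_gt0. Qed.

Lemma cvg_pole : pole j @[j --> \oo] --> (1 : R).
Proof.
rewrite -[X in _ --> X]subr0; apply: cvgB; first exact: cvg_cst.
exact: cvg_harmonic.
Qed.

Lemma cvg_gain_at_pole : gain_at (pole j) @[j --> \oo] --> (1 / 2 : R).
Proof.
rewrite (_ : 1 / 2 = gain_at 1 :> R); last by rewrite /gain_at; field.
apply: cvgM; first exact: cvg_pole.
apply: cvgV => //.
apply: cvgD; first exact: cvg_cst.
by rewrite !expr2; apply: cvgM; exact: cvg_pole.
Qed.

Lemma half_boundary : boundary (feasible pb) (1 / 2)%:M.
Proof.
split; last by move=> /interior_subset; exact: half_not_feasible.
apply: (@closed_cvg _ _ \oo _ (fun j => (gain_at (pole j))%:M) (closure (feasible pb))).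
- exact: closed_closure.
- apply: nearW => j; apply: subset_closure.
  exact: (feasible_gain_at (pole_ge0 j) (pole_lt1 j)).
- exact/cvg_scalar_mx/cvg_gain_at_pole.
Qed.

End ScalarPlant.

(** A cost bounded along the curve t |-> (gain_at t, riccati_at t), t in [0, 1),
    is not coercive, since the end of this curve is on the boundary. *)
Lemma not_coercive_scalar_plant (R : realType) (J : cost_function R) (M : R) :
  (forall t, 0 <= t -> t < 1 -> J _ _ _ _ scalar_plant (riccati_at t)%:M <= M) ->
  not_coercive_in_general J.
Proof.
move=> JM; exists 1%N, 1%N, 1%N, 1%N; split=> //.
exists scalar_plant, (fun j => (gain_at (pole j))%:M),
  (fun j => (riccati_at (pole j))%:M), (1 / 2)%:M.
split.
- by move=> j; exact: (feasible_gain_at (pole_ge0 j) (pole_lt1 j)).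
- by move=> j; exact: (is_P_of_gain_at (pole_ge0 j) (pole_lt1 j)).
- exact/cvg_scalar_mx/cvg_gain_at_pole.
- exact: half_boundary.
- apply: (@bounded_above_not_cvg_pinfty _ _ M) => j.
  exact: (JM _ (pole_ge0 j) (pole_lt1 j)).
Qed.

Theorem lemma3p2 (R : realType) :
  [/\ not_coercive_in_general (@cost_trace R),
      not_coercive_in_general (@cost_logdet R) &
      not_coercive_in_general (@cost_game R)].
Proof.
have den_gt0 := @one_add_sqr_gt0 R.
split.
- apply: (@not_coercive_scalar_plant _ _ 1) => t _ _.
  rewrite /cost_trace /= tr_scalar_mx !mulmx1 mxtrace_scalar mulr1n.
  by rewrite /riccati_at ler_pdivrMr// mul1r lerDr.
- apply: (@not_coercive_scalar_plant _ _ (ln 2)) => t t0 t1.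
  rewrite /cost_logdet /= tr_scalar_mx !mulmx1 expr1n invr1 scale1r -raddfB.
  rewrite det_scalar1 one_sub_riccati_at mulN1r lnV ?posrE// opprK.
  by rewrite ler_ln ?posrE//; nra.
- apply: (@not_coercive_scalar_plant _ _ 1) => t t0 t1.
  rewrite /cost_game /= !tr_scalar_mx !mulmx1 !mul1mx expr1n invr1 scale1r.
  rewrite -raddfB invmx_scalar -scalar_mxM mxtrace_scalar mulr1n.
  rewrite one_sub_riccati_at invrK /riccati_at divfK ?gt_eqF//; nra.
Qed.
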